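(* Let $x\in\mathrm{Aper}(\sigma)$. Then the representation $\pi_x^1$ of $\ell^1(\Sigma)$ on $\ell^1(\mathbb{Z})$ is algebraically irreducible. In fact, for any $\rho=\sum_{n\in\mathbb{Z}}\lambda_ne_n\in\ell^1(\mathbb{Z})$ such that $\rho\neq0$, any $\tau\in\ell^1(\mathbb{Z})$, and any $\varepsilon>0$, there exists $a\in\ell^1(\Sigma)$ such that $\pi_x^1(a)\rho=\tau$ and $$\|a\|\leq\frac{1+\varepsilon}{\max_n|\lambda_n|}\|\tau\|.$$
   Context: $X$ is a non-empty compact Hausdorff space, $\sigma:X\to X$ is a homeomorphism, and $\Sigma=(X,\sigma)$. $\mathrm{Aper}(\sigma)$ is the set of points $x$ with infinite orbit $\{\sigma^nx:n\in\mathbb{Z}\}$. $C(X)$ carries the supremum norm and $\alpha(f)=f\circ\sigma^{-1}$. $\ell^1(\Sigma)$ is the Banach space of all $a:\mathbb{Z}\to C(X)$ with $\|a\|=\sum_n\|a(n)\|<\infty$, with multiplication $(aa')(n)=\sum_{k\in\mathbb{Z}}a(k)\,\alpha^k(a'(n-k))$. Elements are written $a=\sum_nf_n\delta^n$ with $f_n=a(n)$, where $\delta(1)=1$ and $\delta(m)=0$ for $m\ne1$. $e_k$ ($k\in\mathbb{Z}$) are the standard unit vectors of $\ell^1(\mathbb{Z})$ (two-sided complex sequences). For $x\in\mathrm{Aper}(\sigma)$, $\pi_x^1$ is the unital contractive representation of $\ell^1(\Sigma)$ on $\ell^1(\mathbb{Z})$ with $\pi_x^1(f)e_k=f(\sigma^kx)e_k$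 for $f\in C(X)$ and $\pi_x^1(\delta)e_k=e_{k+1}$ ($k\in\mathbb{Z}$), so $\pi_x^1(\sum_nf_n\delta^n)=\sum_n\pi_x^1(f_n)S^n$ with $S$ the right shift. A representation $\pi$ of an algebra $A$ on a vector space $E$ is algebraically irreducible if $\pi(A)E\neq\{0\}$ and the only invariant subspaces are $\{0\}$ and $E$. *)

(* Defs.v *)
From HB Require Import structures.
From mathcomp Require Import all_boot all_order all_algebra.
From mathcomp Require Import mathcomp_extra boolp classical_sets functions.
From mathcomp Require Import cardinality fsbigop reals ereal topology.
From mathcomp Require Import normedtype sequences esum complex lra finmap.

Set Implicit Arguments.
Unset Strict Implicit.
Unset Printing Implicit Defensive.

Import Order.TTheory GRing.Theory Num.Theory.
Import numFieldNormedType.Exports Normc.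

Local Open Scope classical_set_scope.
Local Open Scope ring_scope.
Local Open Scope complex_scope.

Local Notation Re := (@complex.Re _).
Local Notation Im := (@complex.Im _).

HB.instance Definition _ (R : rcfType) := NormedModule.copy R[i] (R[i])^o.

Section nonneg_sums.
Context (R : realType).

Definition nsum (T : choiceType) (g : T -> R) : R :=
  fine (\esum_(t in [set: T]) (g t)%:E).

Definition nfin (T : choiceType) (g : T -> R) : Prop :=
  (forall t, 0 <= g t) /\ (\esum_(t in [set: T]) (g t)%:E < +oo)%E.

Lemma nsumE (T : choiceType) (g : T -> R) : nfin g ->
  (\esum_(t in [set: T]) (g t)%:E)%E = (nsum g)%:E.
Proof.
move=> [g0 goo]; rewrite /nsum fineK// ge0_fin_numE//.
by apply: esum_ge0 => t _; rewrite lee_fin.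
Qed.

Lemma nsum_ge0 (T : choiceType) (g : T -> R) : nfin g -> 0 <= nsum g.
Proof.
by move=> gf; rewrite -lee_fin -nsumE//; apply: esum_ge0 => t _;
  rewrite lee_fin; case: gf.
Qed.

Lemma nfin_le (T : choiceType) (g h : T -> R) :
  (forall t, 0 <= g t <= h t) -> nfin h -> nfin g.
Proof.
move=> gh [h0 hoo]; split; first by move=> t; have /andP[] := gh t.
apply: le_lt_trans hoo; apply: le_esum => t _; rewrite lee_fin.
by have /andP[] := gh t.
Qed.

Lemma nsum_le (T : choiceType) (g h : T -> R) :
  (forall t, 0 <= g t <= h t) -> nfin h -> nsum g <= nsum h.
Proof.
move=> gh hf; have gf := nfin_le gh hf.
rewrite -lee_fin -!nsumE//; apply: le_esum => t _; rewrite lee_fin.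
by have /andP[] := gh t.
Qed.

Lemma nfinD (T : choiceType) (g h : T -> R) :
  nfin g -> nfin h -> nfin (g \+ h).
Proof.
move=> [g0 gf] [h0 hf]; split => [t|]; first exact: addr_ge0.
under eq_esum do rewrite EFinD.
by rewrite esumD ?lte_add_pinfty// => t _; rewrite lee_fin.
Qed.

Lemma nsumD (T : choiceType) (g h : T -> R) :
  nfin g -> nfin h -> nsum (g \+ h) = nsum g + nsum h.
Proof.
move=> gf hf; apply: EFin_inj; rewrite EFinD -!nsumE//; last exact: nfinD.
rewrite -esumD; [|by move=> t _; rewrite lee_fin; case: gf
                 |by move=> t _; rewrite lee_fin; case: hf].
by apply: eq_esum => t _; rewrite EFinD.
Qed.

Lemma esumZl (T : choiceType) (c : R) (g : T -> \bar R) :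
  0 < c -> (forall t, (0 <= g t)%E) ->
  (\esum_(t in [set: T]) (c%:E * g t) = c%:E * \esum_(t in [set: T]) g t)%E.
Proof.
have key d (h : T -> \bar R) : 0 < d -> (forall t, (0 <= h t)%E) ->
  (\esum_(t in [set: T]) (d%:E * h t) <= d%:E * \esum_(t in [set: T]) h t)%E.
  move=> d0 h0; apply: ge_ereal_sup => _ [A [Af AT] <-].
  rewrite fsbig_finite//= -ge0_sume_distrr//.
  apply: lee_wpmul2l; first by rewrite lee_fin ltW.
  by rewrite -fsbig_finite//=; apply: esum_ge; exists A.
move=> c0 g0; apply/eqP; rewrite eq_le key//=.
have cg0 t : (0 <= c%:E * g t)%E by rewrite mule_ge0// lee_fin ltW.
have := key c^-1 (fun t => c%:E * g t)%E; rewrite invr_gt0 => /(_ c0 cg0).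
under eq_esum do rewrite muleA -EFinM mulVf ?gt_eqF// mul1e.
move=> H; apply: le_trans (lee_wpmul2l _ H) _; first by rewrite lee_fin ltW.
by rewrite muleA -EFinM divff ?gt_eqF// mul1e.
Qed.

Lemma nfinZ (T : choiceType) (c : R) (g : T -> R) :
  0 <= c -> nfin g -> nfin (fun t => c * g t).
Proof.
move=> c0 [g0 gf]; split => [t|]; first exact: mulr_ge0.
move: c0; rewrite le_eqVlt => /predU1P[<-|c0].
  by rewrite esum1 ?ltry// => t _; rewrite mul0r.
under eq_esum do rewrite EFinM.
rewrite esumZl//.
by rewrite lte_mul_pinfty// lee_fin ltW.
Qed.

Lemma nsumZ (T : choiceType) (c : R) (g : T -> R) :
  0 <= c -> nfin g -> nsum (fun t => c * g t) = c * nsum g.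
Proof.
move=> c0 gf; apply: EFin_inj; rewrite EFinM -!nsumE//; last exact: nfinZ.
move: c0; rewrite le_eqVlt => /predU1P[<-|c0].
  by rewrite mul0e esum1// => t _; rewrite mul0r.
under eq_esum do rewrite EFinM.
by rewrite esumZl// => t; rewrite lee_fin; case: gf.
Qed.

Lemma esum_reindex (T T' : choiceType) (e : T -> T') (e' : T' -> T)
    (g : T' -> \bar R) : cancel e e' -> cancel e' e ->
  (forall t, (0 <= g t)%E) ->
  (\esum_(t in [set: T]) g (e t) = \esum_(t in [set: T']) g t)%E.
Proof.
move=> ee' e'e g0; symmetry.
apply: (@reindex_esum R T T' setT setT e g) => //.
by split=> [|x y _ _ /(can_inj ee')|y _]//=; exists (e' y) => //; rewrite e'e.
Qed.

Lemma nfin_reindex (T T' : choiceType) (e : T -> T') (e' : T' -> T)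
    (g : T' -> R) : cancel e e' -> cancel e' e -> nfin g -> nfin (g \o e).
Proof.
move=> ee' e'e [g0 gf]; split => [t|]; first exact: g0.
by rewrite (esum_reindex ee' e'e (g := EFin \o g)).
Qed.

Lemma nsum_reindex (T T' : choiceType) (e : T -> T') (e' : T' -> T)
    (g : T' -> R) : cancel e e' -> cancel e' e -> nfin g ->
  nsum (g \o e) = nsum g.
Proof.
move=> ee' e'e [g0 gf]; congr fine.
exact: (esum_reindex ee' e'e (g := EFin \o g)).
Qed.

Lemma nsum_ub (T : choiceType) (g : T -> R) t : nfin g -> g t <= nsum g.
Proof.
move=> gf; rewrite -lee_fin -nsumE//; apply: esum_ge.
by exists [set t]; [split|rewrite fsbig_set1].
Qed.

Lemma nsum1 (T : choiceType) (g : T -> R) t0 :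
  0 <= g t0 -> (forall t, t != t0 -> g t = 0) ->
  nfin g /\ nsum g = g t0.
Proof.
move=> g0 gt0.
have gge0 t : (0 <= (g t)%:E)%E.
  by have [->|/gt0->//] := eqVneq t t0; rewrite lee_fin.
have E : (\esum_(t in [set: T]) (g t)%:E = (g t0)%:E)%E.
  rewrite (esumID [set t0])//= setTI esum_set1// esum1 ?adde0//.
  by move=> t [_ /=] /eqP /gt0->.
by split; [split=> //; rewrite E ltry|rewrite /nsum E].
Qed.

Lemma pair_esum (T1 T2 : choiceType) (g : T1 * T2 -> R) :
  (forall t, 0 <= g t) ->
  (\esum_(i in [set: T1]) \esum_(j in [set: T2]) (g (i, j))%:E =
   \esum_(t in [set: T1 * T2]) (g t)%:E)%E.
Proof.
move=> g0; rewrite (@esum_esum R T1 T2 setT (fun=> setT)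
  (fun i j => (g (i, j))%:E)); last by move=> i j _ _; rewrite lee_fin.
rewrite (_ : [set: T1] `*`` (fun=> [set: T2]) = setT); last first.
  by apply/seteqP; split.
by apply: eq_esum => -[].
Qed.

Lemma nfin_slice (T1 T2 : choiceType) (g : T1 * T2 -> R) i :
  nfin g -> nfin (fun j => g (i, j)).
Proof.
move=> [g0 gf]; split=> //; apply: le_lt_trans gf.
rewrite -pair_esum//; apply: esum_ge; exists [set i]; first by split.
by rewrite fsbig_set1.
Qed.

Lemma nfin_nsum (T1 T2 : choiceType) (g : T1 * T2 -> R) :
  nfin g -> nfin (fun i => nsum (fun j => g (i, j))).
Proof.
move=> gf; split=> [i|]; first by apply/nsum_ge0/nfin_slice.
rewrite (eq_esum (b := fun i => (\esum_(j in [set: T2]) (g (i, j))%:E)%E)).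
  by rewrite pair_esum; case: gf.
by move=> i _; rewrite -nsumE//; exact: nfin_slice.
Qed.

Lemma nsum_pair (T1 T2 : choiceType) (g : T1 * T2 -> R) :
  nfin g -> nsum (fun i => nsum (fun j => g (i, j))) = nsum g.
Proof.
move=> gf; rewrite /nsum; congr fine; rewrite -pair_esum; last by case: gf.
by apply: eq_esum => i _; rewrite -nsumE//; apply: nfin_slice.
Qed.

Lemma nfin_pair (T1 T2 : choiceType) (g : T1 * T2 -> R) :
  (forall i, nfin (fun j => g (i, j))) ->
  nfin (fun i => nsum (fun j => g (i, j))) -> nfin g.
Proof.
move=> gf ggf; have g0 t : 0 <= g t by case: t => i j; case: (gf i).
split=> //; rewrite -pair_esum//.
under eq_esum do rewrite nsumE//.
by case: ggf.
Qed.

End nonneg_sums.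

Section complex_sums.
Context (R : realType).
Local Notation C := R[i].

Lemma normcE (z : C) : `|z| = (normc z)%:C.
Proof. by []. Qed.

Lemma normc_ge0 (z : C) : 0 <= normc z.
Proof. by case: z => a b; exact: sqrtr_ge0. Qed.

Lemma normcD_le (z w : C) : normc (z + w) <= normc z + normc w.
Proof. exact: le_normcD. Qed.

Lemma Re_le_normc (z : C) : `|Re z| <= normc z.
Proof. by rewrite -lecR -normcE normc_ge_Re. Qed.

Lemma Im_le_normc (z : C) : `|Im z| <= normc z.
Proof.
case: z => a b; have := Re_le_normc ((b +i* a) : C).
by rewrite /= addrC.
Qed.

Definition rsum (T : choiceType) (f : T -> R) : R :=
  nsum (fun t => Num.max (f t) 0) - nsum (fun t => Num.max (- f t) 0).

Lemma rsumE (T : choiceType) (f g h : T -> R) : nfin g -> nfin h ->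
  (forall t, f t = g t - h t) -> rsum f = nsum g - nsum h.
Proof.
move=> gf hf fgh.
have [g0 _] := gf; have [h0 _] := hf.
have pf : nfin (fun t => Num.max (f t) 0).
  apply: nfin_le gf => t; rewrite le_max lexx orbT/= ge_max g0 andbT fgh.
  by rewrite gerBl.
have qf : nfin (fun t => Num.max (- f t) 0).
  apply: nfin_le hf => t; rewrite le_max lexx orbT/= ge_max h0 andbT fgh.
  by rewrite opprB gerBl.
apply/eqP; rewrite /rsum subr_eq addrAC eq_sym subr_eq -!nsumD//.
apply/eqP; congr nsum; apply/funext => t /=; rewrite fgh opprB.
case: (leP (g t) (h t)) => gh.
  rewrite (max_l (_ : 0 <= h t - g t)) ?subr_ge0//.
  by rewrite max_r ?subr_le0// addrC subrK add0r.
rewrite max_r ?subr_le0 1?ltW// max_l ?subr_ge0 1?ltW//.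
by rewrite addr0 subrK.
Qed.

Definition cfin (T : choiceType) (u : T -> C) : Prop :=
  nfin (fun t => normc (u t)).

Lemma cfin_le (T : choiceType) (u : T -> C) (g : T -> R) :
  (forall t, normc (u t) <= g t) -> nfin g -> cfin u.
Proof. by move=> ug; apply: nfin_le => t; rewrite normc_ge0 ug. Qed.

Definition csum (T : choiceType) (u : T -> C) : C :=
  rsum (fun t => Re (u t)) +i* rsum (fun t => Im (u t)).

Definition rpos (x : R) := Num.max x 0.

Lemma rpos_bound x : 0 <= rpos x <= `|x|.
Proof. by rewrite /rpos le_max lexx orbT ge_max ler_norm normr_ge0. Qed.

Lemma rposB x : x = rpos x - rpos (- x).
Proof.
rewrite /rpos; case: (leP x 0) => x0.
  by rewrite max_l ?oppr_ge0// opprK add0r.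
by rewrite max_r ?subr0// oppr_le0 ltW.
Qed.

Section parts.
Variables (T : choiceType) (u : T -> C).
Hypothesis uf : cfin u.

Lemma nfin_rep : nfin (fun t => rpos (Re (u t))).
Proof.
apply: nfin_le uf => t; have /andP[-> /= /le_trans] := rpos_bound (Re (u t)).
by apply; exact: Re_le_normc.
Qed.

Lemma nfin_ren : nfin (fun t => rpos (- Re (u t))).
Proof.
apply: nfin_le uf => t; have /andP[-> /= /le_trans] := rpos_bound (- Re (u t)).
by apply; rewrite normrN; exact: Re_le_normc.
Qed.

Lemma nfin_imp : nfin (fun t => rpos (Im (u t))).
Proof.
apply: nfin_le uf => t; have /andP[-> /= /le_trans] := rpos_bound (Im (u t)).
by apply; exact: Im_le_normc.
Qed.

Lemma nfin_imn : nfin (fun t => rpos (- Im (u t))).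
Proof.
apply: nfin_le uf => t; have /andP[-> /= /le_trans] := rpos_bound (- Im (u t)).
by apply; rewrite normrN; exact: Im_le_normc.
Qed.

End parts.
#[local] Hint Resolve nfin_rep nfin_ren nfin_imp nfin_imn : core.

Lemma cfinD (T : choiceType) (u v : T -> C) :
  cfin u -> cfin v -> cfin (u \+ v).
Proof.
move=> uf vf; apply: cfin_le (nfinD uf vf) => t; exact: normcD_le.
Qed.

Lemma cfinZ (T : choiceType) (c : C) (u : T -> C) :
  cfin u -> cfin (fun t => c * u t).
Proof.
move=> uf; apply: cfin_le (nfinZ (normc_ge0 c) uf) => t.
by rewrite normcM.
Qed.

Lemma csumD (T : choiceType) (u v : T -> C) : cfin u -> cfin v ->
  csum (fun t => u t + v t) = csum u + csum v.
Proof.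
move=> uf vf; apply/eqP; rewrite eq_complex /=; apply/andP; split; apply/eqP.
  rewrite (@rsumE _ _ _ _ (nfinD (nfin_rep uf) (nfin_rep vf))
    (nfinD (nfin_ren uf) (nfin_ren vf))).
    by rewrite !nsumD//; [rewrite /rsum opprD addrACA|auto..].
  by move=> t /=; rewrite raddfD/= {1}(rposB (Re (u t))) {1}(rposB (Re (v t))) opprD addrACA.
rewrite (@rsumE _ _ _ _ (nfinD (nfin_imp uf) (nfin_imp vf))
    (nfinD (nfin_imn uf) (nfin_imn vf))).
  by rewrite !nsumD//; [rewrite /rsum opprD addrACA|auto..].
by move=> t /=; rewrite raddfD/= {1}(rposB (Im (u t))) {1}(rposB (Im (v t))) opprD addrACA.
Qed.

Lemma rsumB (T : choiceType) (f g : T -> R) :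
  nfin (fun t => `|f t|) -> nfin (fun t => `|g t|) ->
  rsum (fun t => f t - g t) = rsum f - rsum g.
Proof.
move=> ff gf.
have P h : nfin (fun t : T => `|h t|) -> nfin (fun t => rpos (h t)).
  by apply: nfin_le => t; exact: rpos_bound.
have N h : nfin (fun t : T => `|h t|) -> nfin (fun t => rpos (- h t)).
  by apply: nfin_le => t; rewrite -normrN; exact: rpos_bound.
rewrite (@rsumE _ _ _ _ (nfinD (P _ ff) (N _ gf)) (nfinD (N _ ff) (P _ gf))).
  rewrite !nsumD//; [|by auto..].
  by rewrite /rsum /rpos opprB opprD addrACA.
by move=> t /=; rewrite {1}(rposB (f t)) {1}(rposB (g t)) opprB opprD addrACA.
Qed.

Lemma rsumZ (T : choiceType) (c : R) (f : T -> R) :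
  nfin (fun t => `|f t|) -> rsum (fun t => c * f t) = c * rsum f.
Proof.
move=> ff.
have P : nfin (fun t => rpos (f t)).
  by apply: nfin_le ff => t; exact: rpos_bound.
have N : nfin (fun t => rpos (- f t)).
  by apply: nfin_le ff => t; rewrite -normrN; exact: rpos_bound.
have [c0|c0] := leP 0 c.
  rewrite (@rsumE _ _ _ _ (nfinZ c0 P) (nfinZ c0 N)).
    by rewrite !nsumZ// -mulrBr.
  by move=> t; rewrite -mulrBr -rposB.
have c0' : 0 <= - c by rewrite oppr_ge0 ltW.
rewrite (@rsumE _ _ _ _ (nfinZ c0' N) (nfinZ c0' P)).
  by rewrite !nsumZ// -mulrBr mulNr -mulrN opprB.
by move=> t; rewrite -mulrBr mulNr -mulrN opprB -rposB.
Qed.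

Lemma csumZ (T : choiceType) (c : C) (u : T -> C) : cfin u ->
  csum (fun t => c * u t) = c * csum u.
Proof.
move=> uf.
have ref : nfin (fun t => `|Re (u t)|).
  by apply: nfin_le uf => t; rewrite normr_ge0 Re_le_normc.
have imf : nfin (fun t => `|Im (u t)|).
  by apply: nfin_le uf => t; rewrite normr_ge0 Im_le_normc.
have sc a (f : T -> R) : nfin (fun t => `|f t|) -> nfin (fun t => `|a * f t|).
  by move=> ff; under eq_fun do rewrite normrM; apply: nfinZ.
case: c => a b; rewrite /csum; set X := rsum _; set Y := rsum _.
have -> : X = rsum (fun t => a * Re (u t) - b * Im (u t)).
  by congr rsum; apply/funext => t; case: (u t).
have -> : Y = rsum (fun t => a * Im (u t) - (- b) * Re (u t)).
  by congr rsum; apply/funext => t; case: (u t) => x y /=; rewrite mulNr opprK.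
rewrite !rsumB//; [|by auto..]; rewrite !rsumZ//.
by apply/eqP; rewrite eq_complex/= mulNr opprK !eqxx.
Qed.

Lemma csum_le (T : choiceType) (u : T -> C) : cfin u ->
  normc (csum u) <= nsum (fun t => normc (u t)).
Proof.
move=> uf; have [->|s0] := eqVneq (csum u) 0.
  by rewrite normc0; apply: nsum_ge0.
have n0 : normc (csum u) != 0 by apply: contra s0 => /eqP/eq0_normc ->.
pose c : C := (csum u)^-1 * (normc (csum u))%:C.
have nc : normc c = 1.
  rewrite normcM normcV -[X in _ * X]/(normc (_%:C)) /=.
  rewrite expr0n addr0 sqrtr_sqr ger0_norm ?normc_ge0//.
  by rewrite mulVf.
have : csum (fun t => c * u t) = (normc (csum u))%:C.
  by rewrite csumZ// mulrAC mulVf// mul1r.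
move=> /(congr1 (@complex.Re R))/= <-.
have cuf := cfinZ c uf.
apply: le_trans (_ : nsum (fun t => rpos (Re (c * u t))) <= _).
  by rewrite gerBl; apply: nsum_ge0; exact: nfin_ren.
apply: nsum_le => // t.
have /andP[-> /= /le_trans] := rpos_bound (Re (c * u t)).
by apply; rewrite (le_trans (Re_le_normc _))// normcM nc mul1r.
Qed.

Lemma csum_reindex (T T' : choiceType) (e : T -> T') (e' : T' -> T)
    (u : T' -> C) : cancel e e' -> cancel e' e -> cfin u ->
  csum (u \o e) = csum u.
Proof.
move=> ee' e'e uf; rewrite /csum /rsum.
rewrite (nsum_reindex ee' e'e (nfin_rep uf)).
rewrite (nsum_reindex ee' e'e (nfin_ren uf)).
rewrite (nsum_reindex ee' e'e (nfin_imp uf)).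
by rewrite (nsum_reindex ee' e'e (nfin_imn uf)).
Qed.

Lemma csum1 (T : choiceType) (u : T -> C) t0 :
  (forall t, t != t0 -> u t = 0) -> cfin u /\ csum u = u t0.
Proof.
move=> ut0; split.
  apply: (proj1 (nsum1 (t0 := t0) _ _)); first exact: normc_ge0.
  by move=> t /ut0 ->; rewrite normc0.
have N (g : R -> R) (h : C -> R) : (forall x, 0 <= g x) -> g 0 = 0 -> h 0 = 0 ->
    nsum (fun t => g (h (u t))) = g (h (u t0)).
  move=> g0 g00 h00; apply: (proj2 (nsum1 (t0 := t0) _ _)) => // t /ut0->.
  by rewrite h00.
have p0 x : 0 <= rpos x by have /andP[] := rpos_bound x.
apply/eqP; rewrite eq_complex/= /rsum -!/(rpos _); apply/andP; split; apply/eqP.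
  rewrite (N rpos (@complex.Re R))//; last by rewrite /rpos maxxx.
  rewrite (N (fun x => rpos (- x)) (@complex.Re R))//; last by rewrite /rpos oppr0 maxxx.
  by rewrite -rposB.
rewrite (N rpos (@complex.Im R))//; last by rewrite /rpos maxxx.
rewrite (N (fun x => rpos (- x)) (@complex.Im R))//; last by rewrite /rpos oppr0 maxxx.
by rewrite -rposB.
Qed.

Lemma cfin_slice (T1 T2 : choiceType) (u : T1 * T2 -> C) i :
  cfin u -> cfin (fun j => u (i, j)).
Proof. by move=> /nfin_slice; exact. Qed.

Lemma cfin_csum (T1 T2 : choiceType) (u : T1 * T2 -> C) :
  cfin u -> cfin (fun i => csum (fun j => u (i, j))).
Proof.
move=> uf; apply: cfin_le (nfin_nsum uf) => i.
exact/csum_le/cfin_slice.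
Qed.

Lemma rsum_pair (T1 T2 : choiceType) (g h : T1 * T2 -> R) :
  nfin g -> nfin h ->
  rsum (fun i => nsum (fun j => g (i, j)) - nsum (fun j => h (i, j))) =
  nsum g - nsum h.
Proof.
move=> gf hf; rewrite (@rsumE _ _ _ _ (nfin_nsum gf) (nfin_nsum hf))//.
by rewrite !nsum_pair.
Qed.

Lemma csum_pair (T1 T2 : choiceType) (u : T1 * T2 -> C) :
  cfin u -> csum (fun i => csum (fun j => u (i, j))) = csum u.
Proof.
move=> uf; apply/eqP; rewrite eq_complex/=; apply/andP; split; apply/eqP.
  exact: (rsum_pair (nfin_rep uf) (nfin_ren uf)).
exact: (rsum_pair (nfin_imp uf) (nfin_imn uf)).
Qed.

Lemma csum_exchange (T1 T2 : choiceType) (u : T1 * T2 -> C) :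
  cfin u -> csum (fun i => csum (fun j => u (i, j))) =
            csum (fun j => csum (fun i => u (i, j))).
Proof.
move=> uf; rewrite csum_pair//.
pose sw (A B : choiceType) (p : A * B) := (p.2, p.1).
have sK (A B : choiceType) : cancel (@sw A B) (@sw B A) by case.
rewrite -(csum_reindex (sK T2 T1) (sK T1 T2) uf).
symmetry; apply: (@csum_pair T2 T1 (u \o @sw T2 T1)).
exact: (nfin_reindex (sK T2 T1) (sK T1 T2) uf).
Qed.

End complex_sums.

Section integer_series.
Context (R : realType).
Local Notation C := R[i].

Definition restr (V : zmodType) (T : choiceType) (A : set T) (u : T -> V) t :=
  if t \in A then u t else 0.

Lemma nfin_restr (T : choiceType) (A : set T) (g : T -> R) :
  nfin g -> nfin (restr A g).
Proof.
move=> gf; apply: nfin_le (gf) => t; case: gf => g0 _.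
by rewrite /restr; case: ifP => _; rewrite lexx g0.
Qed.

Lemma nsum_tail (T : choiceType) (g : T -> R) (e : R) : nfin g -> 0 < e ->
  exists2 F : set T, finite_set F & nsum (restr (~` F) g) < e.
Proof.
move=> gf e0; have [g0 goo] := gf.
have gfin : (\esum_(t in [set: T]) (g t)%:E)%E \is a fin_num by rewrite nsumE.
have [_ [F [Ff _] <-] Fe] := ub_ereal_sup_adherent e0 gfin.
exists F => //.
have Ffin : nfin (restr F g) by exact: nfin_restr.
have Cfin : nfin (restr (~` F) g) by exact: nfin_restr.
have E : nsum g = nsum (restr F g) + nsum (restr (~` F) g).
  rewrite -nsumD//; congr nsum; apply/funext => t /=; rewrite /restr in_setC.
  by case: (t \in F); rewrite /= ?addr0 ?add0r.
have FE : (\sum_(t \in F) (g t)%:E = (nsum (restr F g))%:E)%E.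
  rewrite -nsumE// -esum_fset//; last by move=> t _; rewrite lee_fin.
  rewrite esum_mkcond; apply: eq_esum => t _.
  by rewrite /restr; case: ifP.
move: Fe; rewrite FE -/(esum _ _) nsumE// lte_fin E; lra.
Qed.

Lemma ccvgP (T : Type) (F : set_system T) (FF : Filter F) (f : T -> C) (l : C) :
  f @ F --> l <-> forall e : R, 0 < e -> \forall t \near F, normc (l - f t) < e.
Proof.
split.
  move=> /cvgrPdist_lt H e e0; have := H e%:C; rewrite ltcR => /(_ e0).
  by apply: filterS => t; rewrite normcE ltcR.
move=> H; apply/cvgrPdist_lt => e; rewrite ltcE => /andP[/eqP ie re].
have := H _ re; apply: filterS => t; rewrite normcE ltcE/= => ->.
by rewrite ie eqxx.
Qed.

Lemma cfin_restr (T : choiceType) (A : set T) (u : T -> C) :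
  cfin u -> cfin (restr A u).
Proof.
move=> uf; apply: cfin_le (uf) => t.
by rewrite /restr; case: ifP => _; rewrite // normc0 normc_ge0.
Qed.

Lemma normc_restr (T : choiceType) (A : set T) (u : T -> C) t :
  normc (restr A u t) = restr A (fun t => normc (u t)) t.
Proof. by rewrite /restr; case: ifP; rewrite ?normc0. Qed.

Lemma csum_restrU (T : choiceType) (A B : set T) (u : T -> C) :
  cfin u -> A `&` B = set0 ->
  csum (restr (A `|` B) u) = csum (restr A u) + csum (restr B u).
Proof.
move=> uf AB; rewrite -csumD; [|exact: cfin_restr..].
congr csum; apply/funext => t; rewrite /restr in_setU.
case: (boolP (t \in A)) => tA; case: (boolP (t \in B)) => tB /=;
  rewrite ?addr0 ?add0r//.
have : (A `&` B) t by split; exact: set_mem.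
by rewrite AB.
Qed.

Lemma csum_restr1 (T : choiceType) (t0 : T) (u : T -> C) :
  csum (restr [set t0] u) = u t0.
Proof.
rewrite (proj2 (csum1 (t0 := t0) _)) => [|t tt0]; rewrite /restr.
  by rewrite mem_set.
by rewrite memNset// => /= /eqP; rewrite (negbTE tt0).
Qed.

Lemma csum_series (T : choiceType) (e : nat -> T) (u : T -> C) :
  injective e -> cfin u -> series (u \o e) @ \oo --> csum (restr (range e) u).
Proof.
move=> ei uf; apply/ccvgP => d d0.
have [F Ff Fd] := nsum_tail uf d0.
have eF : finite_set (e @^-1` F) by apply: finite_preimage Ff; exact: in2W.
have /finite_fsetP[G GE] := eF.
pose N0 := (\max_(i <- G) i).+1.
have hd n : series (u \o e) n = csum (restr (e @` `I_n) u).
  elim: n => [|n IH].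
    rewrite /series/= big_geq// II0 image_set0.
    rewrite (_ : restr _ _ = fun=> 0); last first.
      by apply/funext => t; rewrite /restr in_set0.
    by rewrite (proj2 (csum1 (t0 := e 0%N) _)).
  have -> : series (u \o e) n.+1 = series (u \o e) n + u (e n).
    by rewrite /series/= big_nat_recr.
  rewrite IH.
  have -> : e @` `I_n.+1 = e @` `I_n `|` [set e n].
    apply/seteqP; split => [_ [k /= kn <-]|_ [[k /= kn <-]|/= ->]].
    - by move: kn; rewrite ltnS leq_eqVlt => /predU1P[->|kn];
        [right|left; exists k].
    - by exists k => //=; exact: ltnW.
    - by exists n => /=.
  rewrite csum_restrU// ?csum_restr1//.
  apply/seteqP; split => // _ [[k /= kn <-] /= /ei kE].
  by move: kn; rewrite kE ltnn.
exists N0 => // n /= N0n.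
have -> : range e = e @` `I_n `|` e @` [set k | (n <= k)%N].
  apply/seteqP; split => [_ [k _ <-]|_ [|] [k _ <-]]; last 2 first.
  - by exists k.
  - by exists k.
  by case: (ltnP k n) => kn; [left|right]; exists k.
rewrite csum_restrU//; last first.
  apply/seteqP; split => // _ [[k /= kn <-] [l /= nl /ei lE]].
  by move: kn; rewrite -lE ltnNge nl.
rewrite hd addrC addKr.
apply: le_lt_trans (csum_le (cfin_restr _ uf)) _.
apply: le_lt_trans Fd; apply: nsum_le; last exact: nfin_restr.
move=> t; rewrite normc_ge0/= normc_restr /restr in_setC.
case: ifPn => [/set_mem[k /= nk <-]|_]; last first.
  by case: ifP => // _; rewrite normc_ge0.
rewrite ifT//; apply/negP => /set_mem ekF.
have : (k \in G)%fset by have : (e @^-1` F) k by []; rewrite GE.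
move=> kG; have : (k <= \max_(i <- G) i)%N by exact: leq_bigmax_seq.
by rewrite leqNgt (leq_trans N0n).
Qed.

(* A sum over [int], as the sum of two one-sided series. All the families    *)
(* summed below are absolutely summable; for those, zsumE identifies it with *)
(* [csum], which does not depend on any ordering of the terms.               *)
Definition zsum (u : int -> C) : C :=
  limn (series (fun n => u (Posz n))) + limn (series (fun n => u (Negz n))).

Lemma zsumE (u : int -> C) : cfin u -> zsum u = csum u.
Proof.
move=> uf; have iP : injective Posz by move=> ? ? [].
have iN : injective Negz by move=> ? ? [].
rewrite /zsum (cvg_lim _ (csum_series iP uf)); last exact: norm_hausdorff.
rewrite (cvg_lim _ (csum_series iN uf)); last exact: norm_hausdorff.
rewrite -csum_restrU//; last first.
  by apply/seteqP; split => // _ [[k _ <-] []].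
congr csum; apply/funext => -[n|n]; rewrite /restr mem_set//.
  by left; exists n.
by right; exists n.
Qed.

End integer_series.

Section zsum_theory.
Context (R : realType).
Local Notation C := R[i].
Implicit Types (u v : int -> C) (g h : int -> R).

Lemma nfin_conv2 g h : nfin g -> nfin h ->
  nfin (fun p : int * int => g p.2 * h (p.1 - p.2)) /\
  nsum (fun p : int * int => g p.2 * h (p.1 - p.2)) = nsum g * nsum h.
Proof.
move=> gf hf; have [g0 _] := gf; have [h0 _] := hf.
pose f (p : int * int) := g p.1 * h p.2.
have slf i : nfin (fun j => f (i, j)) by exact: (nfinZ (g0 i) hf).
have ff : nfin f.
  apply: nfin_pair => //.
  have -> : (fun i => nsum (fun j => f (i, j))) = (fun i => nsum h * g i).
    by apply/funext => i; rewrite mulrC -(nsumZ (g0 i) hf).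
  by apply: nfinZ => //; exact: nsum_ge0.
have fs : nsum f = nsum g * nsum h.
  rewrite -nsum_pair//.
  have -> : (fun i => nsum (fun j => f (i, j))) = (fun i => nsum h * g i).
    by apply/funext => i; rewrite mulrC -(nsumZ (g0 i) hf).
  by rewrite nsumZ ?nsum_ge0// mulrC.
pose e (p : int * int) := (p.2, p.1 - p.2).
pose e' (p : int * int) := (p.2 + p.1, p.1).
have ee' : cancel e e' by case=> a b; rewrite /e /e' /= subrK.
have e'e : cancel e' e by case=> a b; rewrite /e /e' /= addrK.
split; first exact: (nfin_reindex ee' e'e ff).
by rewrite -fs; exact: (nsum_reindex ee' e'e ff).
Qed.

Lemma nfin_conv1 g h n : nfin g -> nfin h -> nfin (fun k => g k * h (n - k)).
Proof. by move=> gf hf; exact: (nfin_slice n (proj1 (nfin_conv2 gf hf))). Qed.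

Lemma nfin_conv g h : nfin g -> nfin h ->
  nfin (fun n => nsum (fun k => g k * h (n - k))).
Proof. by move=> gf hf; exact: (nfin_nsum (proj1 (nfin_conv2 gf hf))). Qed.

Lemma nsum_conv g h : nfin g -> nfin h ->
  nsum (fun n => nsum (fun k => g k * h (n - k))) = nsum g * nsum h.
Proof.
move=> gf hf; rewrite -(proj2 (nfin_conv2 gf hf)).
by rewrite -nsum_pair//; exact: (proj1 (nfin_conv2 gf hf)).
Qed.

Lemma zsum_le u g : (forall n, normc (u n) <= g n) -> nfin g ->
  normc (zsum u) <= nsum g.
Proof.
move=> ug gf; have uf := cfin_le ug gf; rewrite zsumE//.
apply: le_trans (csum_le uf) _; apply: nsum_le => // n.
by rewrite normc_ge0 ug.
Qed.

Lemma zsumD u v : cfin u -> cfin v ->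
  zsum (fun n => u n + v n) = zsum u + zsum v.
Proof. by move=> uf vf; rewrite !zsumE// ?csumD//; exact: cfinD. Qed.

Lemma zsumZ c u : cfin u -> zsum (fun n => c * u n) = c * zsum u.
Proof. by move=> uf; rewrite !zsumE// ?csumZ//; exact: cfinZ. Qed.

Lemma zsum1 u k : (forall n, n != k -> u n = 0) -> zsum u = u k.
Proof. by move=> /csum1[uf uE]; rewrite zsumE. Qed.

(* Associativity of twisted convolution and multiplicativity of [pi1] are *)
(* both instances of this identity.                                       *)
Lemma zsum_assoc (p : int -> C) (q : int -> int -> C) (r : int -> C)
    (P Q : int -> R) (M : R) : nfin P -> nfin Q ->
  (forall k, normc (p k) <= P k) -> (forall k j, normc (q k j) <= Q j) ->
  (forall i, normc (r i) <= M) ->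
  zsum (fun k => p k * zsum (fun j => q k j * r (k + j))) =
  zsum (fun i => zsum (fun k => p k * q k (i - k)) * r i).
Proof.
move=> Pf Qf pP qQ rM; have [P0 _] := Pf; have [Q0 _] := Qf.
have M0 : 0 <= M by apply: le_trans (rM 0); exact: normc_ge0.
pose w (t : int * int) := p t.2 * q t.2 (t.1 - t.2) * r t.1.
have wf : cfin w.
  apply: (@cfin_le _ _ _ (fun t => M * (P t.2 * Q (t.1 - t.2)))).
    move=> [i k]; rewrite /w /= !normcM mulrC ler_pM ?mulr_ge0 ?normc_ge0//.
    by rewrite ler_pM ?normc_ge0.
  by apply: nfinZ => //; exact: (proj1 (nfin_conv2 Pf Qf)).
have -> : zsum (fun i => zsum (fun k => p k * q k (i - k)) * r i) =
          csum (fun i => csum (fun k => w (i, k))).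
  rewrite -zsumE; last exact: cfin_csum.
  congr zsum; apply/funext => i; rewrite mulrC -zsumZ; last first.
    apply: (@cfin_le _ _ _ (fun k => P k * Q (i - k))).
      by move=> k; rewrite normcM ler_pM ?normc_ge0.
    exact: nfin_conv1.
  rewrite -(zsumE (cfin_slice i wf)); congr zsum; apply/funext => k.
  by rewrite mulrC.
rewrite csum_exchange// -zsumE; last first.
  pose sw (t : int * int) := (t.2, t.1).
  have sK : cancel sw sw by case.
  by apply: (@cfin_csum _ _ _ (w \o sw)); exact: (nfin_reindex sK sK wf).
congr zsum; apply/funext => k.
have qf : cfin (fun j => q k j * r (k + j)).
  apply: (@cfin_le _ _ _ (fun j => M * Q j)); last exact: nfinZ.
  by move=> j; rewrite normcM mulrC ler_pM ?normc_ge0.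
rewrite -zsumZ// zsumE; last exact: cfinZ.
have aK : cancel (+%R k) (fun i => i - k) by move=> j; rewrite addrC addKr.
have Ka : cancel (fun i => i - k) (+%R k) by move=> j; rewrite addrC subrK.
rewrite -(csum_reindex aK Ka (u := fun i => w (i, k))).
  by congr csum; apply/funext => j; rewrite /w /= mulrA (addrC k) addrK.
pose sw (t : int * int) := (t.2, t.1).
have sK : cancel sw sw by case.
exact: (cfin_slice k (nfin_reindex sK sK wf : cfin (w \o sw))).
Qed.

Lemma zsum_continuous (T : topologicalType) (u : int -> T -> C) g :
  (forall n, continuous (u n)) -> (forall n x, normc (u n x) <= g n) ->
  nfin g -> continuous (fun x => zsum (u^~ x)).
Proof.
move=> uc ug gf x; have uf y : cfin (u^~ y) by exact: cfin_le gf.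
have fc (F : set int) : finite_set F ->
    continuous (fun y => csum (restr F (u^~ y))).
  move=> /finite_seqP[s ->] {F}; elim: s => [|k s IH] y.
    rewrite (_ : (fun _ => _) = fun=> 0); first exact: cvg_cst.
    apply/funext => z; rewrite (_ : restr _ _ = fun=> 0).
      by rewrite (proj2 (csum1 (t0 := (0 : int)) _)).
    by apply/funext => t; rewrite /restr memNset.
  case: (boolP (k \in s)) => ks.
    rewrite (_ : [set` k :: s] = [set` s])//.
    apply/seteqP; split=> t /=; rewrite inE; first by case/predU1P => [->|].
    by move=> ->; rewrite orbT.
  have D : [set k] `&` [set` s] = set0.
    by apply/seteqP; split => // t [/= ->]; rewrite (negbTE ks).
  have -> : [set` k :: s] = [set k] `|` [set` s].
    apply/seteqP; split=> t /=; rewrite in_cons.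
      by case/predU1P => [|]; [left|right].
    by case=> ->; rewrite ?eqxx ?orbT.
  under eq_fun => z do rewrite (csum_restrU (uf z) D) csum_restr1.
  by apply: cvgD; [exact: uc|exact: IH].
apply/ccvgP => e e0.
have e3 : 0 < e / 3 by rewrite divr_gt0.
have [F Ff Fe] := nsum_tail gf e3.
have /ccvgP/(_ _ e3) := fc F Ff x.
apply: filterS => y; set A := csum _; set B := csum _ => AB.
have E z : zsum (u^~ z) = csum (restr F (u^~ z)) + csum (restr (~` F) (u^~ z)).
  rewrite zsumE// -csum_restrU// ?setICr// setUv; congr csum.
  by apply/funext => t; rewrite /restr in_setT.
have tl z : normc (csum (restr (~` F) (u^~ z))) < e / 3.
  apply: le_lt_trans (csum_le (cfin_restr _ (uf z))) _.
  apply: le_lt_trans Fe; apply: nsum_le => [t|]; last exact: nfin_restr.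
  rewrite normc_ge0 normc_restr /restr/=; case: ifP => // _; exact: lexx.
rewrite !E -/A -/B; set D := csum _; set D' := csum _.
rewrite opprD addrACA; apply: le_lt_trans (normcD_le _ _) _.
have := normcD_le D (- D'); rewrite normcN.
have := tl x; have := tl y; rewrite -/D -/D'.
lra.
Qed.

End zsum_theory.

(* sigmaV is the inverse of the homeomorphism sigma. *)
Record dynSys := DynSys {
  dyn_space :> topologicalType;
  dyn_nonempty : [set: dyn_space] !=set0;
  dyn_compact : compact [set: dyn_space];
  dyn_hausdorff : hausdorff_space dyn_space;
  sigma : dyn_space -> dyn_space;
  sigmaV : dyn_space -> dyn_space;
  sigmaK : cancel sigma sigmaV;
  sigmaVK : cancel sigmaV sigma;
  sigma_continuous : continuous sigma;
  sigmaV_continuous : continuous sigmaV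
}.

Section dynamics.
Context (Sg : dynSys).

Definition sigmaz (k : int) : Sg -> Sg :=
  match k with
  | Posz n => iter n (@sigma Sg)
  | Negz n => iter n.+1 (@sigmaV Sg)
  end.

Definition dyn_orbit (x : Sg) : set Sg := [set sigmaz n x | n in [set: int]].

Definition Aper : set Sg := [set x | infinite_set (dyn_orbit x)].

Lemma sigmazS k y : sigmaz (k + 1) y = sigma (sigmaz k y).
Proof.
case: k => [n|[|n]].
- by rewrite -PoszD addn1.
- by rewrite /= sigmaVK.
- rewrite (_ : Negz n.+1 + 1 = Negz n); first by rewrite /= sigmaVK.
  by rewrite !NegzE -[n.+2]addn1 PoszD opprD subrK.
Qed.

Lemma sigmazP k y : sigmaz (k - 1) y = sigmaV (sigmaz k y).
Proof. by rewrite -[in RHS](subrK 1 k) sigmazS sigmaK. Qed.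

Lemma sigmazD j k y : sigmaz (j + k) y = sigmaz j (sigmaz k y).
Proof.
elim/int_ind: j y => [|n IH|n IH] y; first by rewrite add0r.
  by rewrite -addn1 PoszD addrAC !sigmazS IH.
by rewrite -addn1 PoszD opprD addrAC !sigmazP IH.
Qed.

Lemma sigmaz_continuous k : continuous (sigmaz k).
Proof.
elim/int_ind: k => [|n IH|n IH] y.
- exact: cvg_id.
- rewrite (_ : sigmaz _ = @sigma Sg \o sigmaz n).
    by apply: continuous_comp; [exact: IH|exact: sigma_continuous].
  by apply/funext => z; rewrite -addn1 PoszD sigmazS.
- rewrite (_ : sigmaz _ = @sigmaV Sg \o sigmaz (- n%:Z)).
    by apply: continuous_comp; [exact: IH|exact: sigmaV_continuous].
  by apply/funext => z; rewrite -addn1 PoszD opprD sigmazP.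
Qed.

End dynamics.

Section l1.
Context (R : realType).
Local Notation C := R[i].

Definition l1Z_pred : {pred int -> C} :=
  mem [set u | summable [set: int] (fun n => (normc (u n))%:E)].

Record l1Z := L1Z { l1Z_val :> int -> C; l1Z_mem : l1Z_val \in l1Z_pred }.

HB.instance Definition _ := [isSub for l1Z_val].
HB.instance Definition _ := [Choice of l1Z by <:].

Lemma l1Z_predP (u : int -> C) : u \in l1Z_pred <-> cfin u.
Proof.
rewrite -[u \in _]/(u \in [set u | summable setT (fun n => (normc (u n))%:E)]).
rewrite in_setE /= /summable.
under eq_esum do rewrite gee0_abs ?lee_fin ?normc_ge0//.
by split=> [uoo|[]]//; split=> // t; exact: normc_ge0.
Qed.

Lemma l1Z_cfin (u : l1Z) : cfin u.
Proof. exact/l1Z_predP/l1Z_mem. Qed.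

Lemma l1Z_submod_closed : submod_closed l1Z_pred.
Proof.
split; first by apply/l1Z_predP; exact: (proj1 (csum1 (t0 := 0) _)).
move=> c u v /l1Z_predP uf /l1Z_predP vf; apply/l1Z_predP.
exact: (cfinD (cfinZ c uf) vf).
Qed.

HB.instance Definition _ :=
  GRing.isSubmodClosed.Build _ _ l1Z_pred l1Z_submod_closed.
HB.instance Definition _ := [SubChoice_isSubLmodule of l1Z by <:].

Definition l1Z_norm (u : l1Z) : R :=
  fine (\esum_(n in [set: int]) (normc (u n))%:E).

Context (Sg : dynSys).
Implicit Types (f : Sg -> C) (a b c : int -> Sg -> C).

Definition supnorm f : R := sup (range (fun x => normc (f x))).

Definition l1Sigma_pred : {pred int -> Sg -> C} :=
  mem [set a | (forall n, continuous (a n)) /\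
               summable [set: int] (fun n => (supnorm (a n))%:E)].

Record l1Sigma :=
  L1Sigma { l1Sigma_val :> int -> Sg -> C;
            l1Sigma_mem : l1Sigma_val \in l1Sigma_pred }.

HB.instance Definition _ := [isSub for l1Sigma_val].
HB.instance Definition _ := [Choice of l1Sigma by <:].

Definition l1Sigma_norm (a : l1Sigma) : R :=
  fine (\esum_(n in [set: int]) (supnorm (a n))%:E).

Lemma normc_continuous f : continuous f -> continuous (fun x => normc (f x)).
Proof.
move=> fc x; apply/cvgrPdist_lt => e e0.
have /ccvgP/(_ _ e0) := fc x; apply: filterS => y; apply: le_lt_trans.
have H (z w : C) : normc z - normc w <= normc (z - w).
  by rewrite lerBlDr (le_trans _ (normcD_le _ _))// subrK.
rewrite ler_norml H andbT lerNl opprB (le_trans (H _ _))//.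
by rewrite -opprB normcN.
Qed.

Lemma supnorm_has_sup f : continuous f ->
  has_sup (range (fun x => normc (f x))).
Proof.
move=> fc; apply: compact_has_sup.
  by have [x _] := dyn_nonempty Sg; exists (normc (f x)), x.
apply: continuous_compact (@dyn_compact Sg).
by apply: continuous_subspaceT; exact: normc_continuous.
Qed.

Lemma supnorm_ub f x : continuous f -> normc (f x) <= supnorm f.
Proof.
by move=> /supnorm_has_sup[_ fs]; apply: ub_le_sup => //; exists x.
Qed.

Lemma supnorm_le f M : (forall x, normc (f x) <= M) -> supnorm f <= M.
Proof.
move=> fM; apply: ge_sup; last by move=> _ [x _ <-].
by have [x _] := dyn_nonempty Sg; exists (normc (f x)), x.
Qed.

Lemma supnorm_ge0 f : continuous f -> 0 <= supnorm f.
Proof.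
move=> fc; have [x _] := dyn_nonempty Sg.
by apply: le_trans (supnorm_ub x fc); exact: normc_ge0.
Qed.

Lemma l1Sigma_predP a : a \in l1Sigma_pred <->
  (forall n, continuous (a n)) /\ nfin (fun n => supnorm (a n)).
Proof.
rewrite -[a \in _]/(a \in [set a | (forall n, continuous (a n)) /\
  summable setT (fun n => (supnorm (a n))%:E)]).
rewrite in_setE /= /summable; split=> -[ac]; have a0 n := supnorm_ge0 (ac n).
  under eq_esum do rewrite gee0_abs ?lee_fin//.
  by move=> ?; split.
move=> [_ aoo]; split=> //.
by under eq_esum do rewrite gee0_abs ?lee_fin//.
Qed.

Lemma l1Sigma_cont (a : l1Sigma) n : continuous (a n).
Proof. by have /l1Sigma_predP[] := l1Sigma_mem a. Qed.

Lemma l1Sigma_nfin (a : l1Sigma) : nfin (fun n => supnorm (a n)).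
Proof. by have /l1Sigma_predP[] := l1Sigma_mem a. Qed.

Lemma l1Sigma_ub (a : l1Sigma) n x : normc (a n x) <= supnorm (a n).
Proof. exact/supnorm_ub/l1Sigma_cont. Qed.

Lemma l1Sigma_intro a (g : int -> R) : (forall n, continuous (a n)) ->
  (forall n x, normc (a n x) <= g n) -> nfin g -> a \in l1Sigma_pred.
Proof.
move=> ac ag gf; apply/l1Sigma_predP; split=> //; apply: nfin_le gf => n.
by rewrite supnorm_ge0//= supnorm_le.
Qed.

Lemma l1Sigma_submod_closed : submod_closed l1Sigma_pred.
Proof.
split.
  apply: (@l1Sigma_intro _ (fun=> 0)) => [n|n x|].
  - exact: (@cst_continuous _ _ (0 : C)).
  - by rewrite normc0.
  - by have [] := @nsum1 R int (fun=> 0) 0 (lexx _).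
move=> k a b /l1Sigma_predP[ac af] /l1Sigma_predP[bc bf].
apply: (@l1Sigma_intro _ (fun n => normc k * supnorm (a n) + supnorm (b n))).
- move=> n x; apply: cvgD; last exact: bc.
  by apply: cvgM; [exact: cvg_cst|exact: ac].
- move=> n x; apply: le_trans (normcD_le _ _) _; apply: lerD.
    by rewrite normcM ler_wpM2l ?normc_ge0// supnorm_ub.
  exact: supnorm_ub.
- exact: (nfinD (nfinZ (normc_ge0 k) af) bf).
Qed.

HB.instance Definition _ :=
  GRing.isSubmodClosed.Build _ _ l1Sigma_pred l1Sigma_submod_closed.
HB.instance Definition _ := [SubChoice_isSubLmodule of l1Sigma by <:].

(* The [k]-th power of [alpha f := f \o sigma^-1]. *)
Definition alphaz (k : int) f : Sg -> C := f \o sigmaz (- k).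

(* The product of l1Sigma, evaluated pointwise: the defining series converges *)
(* absolutely in C(X) (see conv_bound), so its values are the pointwise sums. *)
Definition conv a b : int -> Sg -> C :=
  fun n y => zsum (fun k => a k y * alphaz k (b (n - k)) y).

(* [f \delta^n] *)
Definition monomial f (n : int) : int -> Sg -> C :=
  fun m => if m == n then f else 0.

Lemma monomial_mem f n : continuous f -> monomial f n \in l1Sigma_pred.
Proof.
move=> fc; apply: (@l1Sigma_intro _ (fun m => if m == n then supnorm f else 0)).
- move=> m; rewrite /monomial; case: eqP => _; first exact: fc.
  exact: (@cst_continuous _ _ (0 : C)).
- move=> m x; rewrite /monomial; case: eqP => // _; last by rewrite normc0.
  exact: supnorm_ub.
- apply: (proj1 (nsum1 (t0 := n) _ _)); first by rewrite eqxx supnorm_ge0.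
  by move=> m /negbTE->.
Qed.

Lemma conv_bound (a b : l1Sigma) n k y :
  normc (a k y * alphaz k (b (n - k)) y) <=
  supnorm (a k) * supnorm (b (n - k)).
Proof. by rewrite normcM ler_pM ?normc_ge0// l1Sigma_ub. Qed.

Lemma conv_cfin (a b : l1Sigma) n y :
  cfin (fun k => a k y * alphaz k (b (n - k)) y).
Proof.
apply: cfin_le (nfin_conv1 n (l1Sigma_nfin a) (l1Sigma_nfin b)) => k.
exact: conv_bound.
Qed.

Lemma conv_mem (a b : l1Sigma) : conv a b \in l1Sigma_pred.
Proof.
apply: l1Sigma_intro (nfin_conv (l1Sigma_nfin a) (l1Sigma_nfin b)) => n.
  apply: zsum_continuous (nfin_conv1 n (l1Sigma_nfin a) (l1Sigma_nfin b)).
    move=> k x; apply: cvgM; first exact: l1Sigma_cont.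
    by apply: continuous_comp; [exact: sigmaz_continuous|exact: l1Sigma_cont].
  by move=> k x; exact: conv_bound.
move=> x; apply: zsum_le; last exact: nfin_conv1 (l1Sigma_nfin a) (l1Sigma_nfin b).
by move=> k; exact: conv_bound.
Qed.

Lemma cst1_continuous : continuous ((fun=> 1) : Sg -> C).
Proof. by move=> x; exact: cvg_cst. Qed.

Definition l1Sigma_mul (a b : l1Sigma) : l1Sigma := L1Sigma (conv_mem a b).

Definition l1Sigma_monomial f (fc : continuous f) (n : int) : l1Sigma :=
  L1Sigma (monomial_mem n fc).

Definition l1Sigma_one : l1Sigma := l1Sigma_monomial cst1_continuous 0.

Lemma l1SigmaP (a b : l1Sigma) : (forall n y, a n y = b n y) -> a = b.
Proof. by move=> ab; apply/val_inj/funext => n; apply/funext => y; exact: ab. Qed.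

Lemma l1Sigma_mulA : associative l1Sigma_mul.
Proof.
move=> a b c; apply: l1SigmaP => n y /=.
pose q k j := alphaz k (b j) y.
pose r i := alphaz i (c (n - i)) y.
have := @zsum_assoc R (a^~ y) q r _ _ (nsum (fun i => supnorm (c i)))
  (l1Sigma_nfin a) (l1Sigma_nfin b) (fun k => l1Sigma_ub a k y)
  (fun k j => l1Sigma_ub b j _).
have rM i : normc (r i) <= nsum (fun i => supnorm (c i)).
  apply: le_trans (l1Sigma_ub _ _ _) _.
  exact: (nsum_ub (n - i) (l1Sigma_nfin c)).
move=> /(_ rM) H; rewrite /conv -[RHS]H; congr zsum; apply/funext => k.
congr (_ * _); congr zsum; apply/funext => j.
by rewrite /q /r /alphaz /= -sigmazD !opprD addrA [- j - k]addrC.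
Qed.

Lemma l1Sigma_mul1 : left_id l1Sigma_one l1Sigma_mul.
Proof.
move=> a; apply: l1SigmaP => n y /=; rewrite /conv (zsum1 (k := 0)) => [|k k0].
  by rewrite /monomial eqxx mul1r subr0 /alphaz oppr0.
by rewrite /monomial (negbTE k0) mul0r.
Qed.

Lemma l1Sigma_mulr1 : right_id l1Sigma_one l1Sigma_mul.
Proof.
move=> a; apply: l1SigmaP => n y /=; rewrite /conv (zsum1 (k := n)) => [|k kn].
  by rewrite /alphaz /monomial subrr eqxx mulr1.
by rewrite /alphaz /monomial /= subr_eq0 eq_sym (negbTE kn) mulr0.
Qed.

Lemma l1Sigma_mulDl : left_distributive l1Sigma_mul +%R.
Proof.
move=> a b c; apply: l1SigmaP => n y /=.
rewrite -[RHS]zsumD; [|exact: conv_cfin..].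
by congr zsum; apply/funext => k; rewrite -mulrDl.
Qed.

Lemma l1Sigma_mulDr : right_distributive l1Sigma_mul +%R.
Proof.
move=> a b c; apply: l1SigmaP => n y /=.
rewrite -[RHS]zsumD; [|exact: conv_cfin..].
by congr zsum; apply/funext => k; rewrite -mulrDr.
Qed.

Lemma l1Sigma_1neq0 : l1Sigma_one != 0.
Proof.
have [y _] := dyn_nonempty Sg; apply/eqP => /(congr1 (fun a : l1Sigma => a 0 y)).
by move=> /= /eqP; rewrite /monomial eqxx oner_eq0.
Qed.

HB.instance Definition _ := GRing.Zmodule_isNzRing.Build l1Sigma
  l1Sigma_mulA l1Sigma_mul1 l1Sigma_mulr1 l1Sigma_mulDl l1Sigma_mulDr l1Sigma_1neq0.

Lemma l1Sigma_scalerAl (k : C) (a b : l1Sigma) : k *: (a * b) = (k *: a) * b.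
Proof.
apply: l1SigmaP => n y; rewrite -[LHS]zsumZ; last exact: conv_cfin.
by congr zsum; apply/funext => j; rewrite mulrA.
Qed.

Lemma l1Sigma_scalerAr (k : C) (a b : l1Sigma) : k *: (a * b) = a * (k *: b).
Proof.
apply: l1SigmaP => n y; rewrite -[LHS]zsumZ; last exact: conv_cfin.
by congr zsum; apply/funext => j; rewrite mulrCA.
Qed.

HB.instance Definition _ := GRing.Lmodule_isLalgebra.Build C l1Sigma l1Sigma_scalerAl.
HB.instance Definition _ := GRing.Lalgebra_isAlgebra.Build C l1Sigma l1Sigma_scalerAr.

End l1.

Record representation (K : fieldType) (A : algType K) (E : lmodType K) :=
  Representation {
    rep_fun :> A -> E -> E;
    rep_linearl : forall v, linear (rep_fun^~ v);
    rep_linearr : forall a, linear (rep_fun a);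
    rep_mul : forall a b v, rep_fun (a * b) v = rep_fun a (rep_fun b v)
  }.

(* Subspaces are boolean predicates; classically these are all subsets. *)
Definition alg_irreducible (K : fieldType) (A : algType K) (E : lmodType K)
    (pi : representation A E) : Prop :=
  (exists a v, pi a v != 0) /\
  forall W : {pred E}, submod_closed W ->
    (forall a v, v \in W -> pi a v \in W) ->
    W =i pred1 0 \/ W =i predT.

Section pi1.
Context (R : realType) (Sg : dynSys) (x : Sg).
Local Notation C := R[i].
Local Notation l1Sigma := (l1Sigma R Sg).
Local Notation l1Z := (l1Z R).

(* The [m]-th coordinate of [\sum_n pi(f_n) S^n u], with [f_n := a n] acting *)
(* diagonally by [f_n (sigma^m x)] and [S^n] shifting coordinates by [n];    *)
(* pi1_C, pi1_delta, pi1_unital and pi1_contractive are the properties that  *)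
(* characterize this representation.                                         *)
Definition pi1_val (a : l1Sigma) (u : l1Z) : int -> C :=
  fun m => zsum (fun n => a n (sigmaz m x) * u (m - n)).

Lemma pi1_bound (a : l1Sigma) (u : l1Z) m n :
  normc (a n (sigmaz m x) * u (m - n)) <= supnorm (a n) * normc (u (m - n)).
Proof. by rewrite normcM ler_wpM2r ?normc_ge0// l1Sigma_ub. Qed.

Lemma pi1_cfin (a : l1Sigma) (u : l1Z) m :
  cfin (fun n => a n (sigmaz m x) * u (m - n)).
Proof.
apply: cfin_le (nfin_conv1 m (l1Sigma_nfin a) (l1Z_cfin u)) => n.
exact: pi1_bound.
Qed.

Lemma pi1_le (a : l1Sigma) (u : l1Z) m : normc (pi1_val a u m) <=
  nsum (fun n => supnorm (a n) * normc (u (m - n))).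
Proof.
apply: zsum_le; last exact: (nfin_conv1 m (l1Sigma_nfin a) (l1Z_cfin u)).
by move=> n; exact: pi1_bound.
Qed.

Lemma pi1_mem (a : l1Sigma) (u : l1Z) : pi1_val a u \in @l1Z_pred R.
Proof.
apply/l1Z_predP; apply: cfin_le (nfin_conv (l1Sigma_nfin a) (l1Z_cfin u)).
exact: pi1_le.
Qed.

Definition pi1_fun (a : l1Sigma) (u : l1Z) : l1Z := L1Z (pi1_mem a u).

Lemma l1ZP (u v : l1Z) : (forall n, u n = v n) -> u = v.
Proof. by move=> uv; apply/val_inj/funext. Qed.

Lemma pi1_linearl u : linear (pi1_fun^~ u).
Proof.
move=> k a b; apply: l1ZP => m.
rewrite -[RHS]/(k * pi1_val a u m + pi1_val b u m) -zsumZ; last exact: pi1_cfin.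
rewrite -zsumD; [|exact/cfinZ/pi1_cfin|exact: pi1_cfin].
by congr zsum; apply/funext => n; rewrite mulrA -mulrDl.
Qed.

Lemma pi1_linearr a : linear (pi1_fun a).
Proof.
move=> k u v; apply: l1ZP => m.
rewrite -[RHS]/(k * pi1_val a u m + pi1_val a v m) -zsumZ; last exact: pi1_cfin.
rewrite -zsumD; [|exact/cfinZ/pi1_cfin|exact: pi1_cfin].
by congr zsum; apply/funext => n; rewrite mulrCA -mulrDr.
Qed.

Lemma pi1_mul a b u : pi1_fun (a * b) u = pi1_fun a (pi1_fun b u).
Proof.
apply: l1ZP => m /=; rewrite /pi1_val /=.
pose q k j := b j (sigmaz (m - k) x).
pose r i := u (m - i).
have := @zsum_assoc R (a^~ (sigmaz m x)) q r _ _ (nsum (fun i => normc (u i)))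
  (l1Sigma_nfin a) (l1Sigma_nfin b) (fun k => l1Sigma_ub a k _)
  (fun k j => l1Sigma_ub b j _).
have rM i : normc (r i) <= nsum (fun i => normc (u i)).
  exact: (nsum_ub (m - i) (l1Z_cfin u)).
move=> /(_ rM) H; symmetry; apply: etrans (etrans _ H) _.
  congr zsum; apply/funext => i; congr (_ * _).
  congr zsum; apply/funext => j.
  by rewrite /q /r opprD addrA.
congr zsum; apply/funext => i; congr (_ * _).
rewrite /= /conv; congr zsum; apply/funext => k.
by rewrite /q /alphaz /= -sigmazD [- k + m]addrC.
Qed.

Definition pi1 : representation l1Sigma l1Z :=
  Representation pi1_linearl pi1_linearr pi1_mul.

End pi1.

Section facts.
Context (R : realType) (Sg : dynSys).
Local Notation C := R[i].

(* The supremum is a maximum, by l1Z_max_attained. *)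
Definition l1Z_max (u : l1Z R) : R := sup (range (fun n => normc (u n))).

Lemma l1Z_max_attained (u : l1Z R) :
  exists N, l1Z_max u = normc (u N) /\ forall n, normc (u n) <= normc (u N).
Proof.
have uf := l1Z_cfin u.
suff [N HN] : exists N, forall n, normc (u n) <= normc (u N).
  exists N; split=> //; apply/eqP; rewrite eq_le; apply/andP; split.
    apply: ge_sup => [|_ [n _ <-]]; last exact: HN.
    by exists (normc (u N)), N.
  apply: ub_le_sup; last by exists N.
  by exists (normc (u N)) => _ [n _ <-]; exact: HN.
have [[n0 n0P]|/forallNP un0] := pselect (exists n, 0 < normc (u n)); last first.
  exists 0 => n; have := un0 n; move/negP; rewrite -leNgt => /le_trans; apply.
  exact: normc_ge0.
have [F /finite_seqP[s ->] Fe] := nsum_tail uf n0P.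
pose N := foldr (fun k l => if normc (u k) <= normc (u l) then l else k) n0 s.
have [N0 Ns] : normc (u n0) <= normc (u N) /\
    forall k, k \in s -> normc (u k) <= normc (u N).
  rewrite /N; elim: s {Fe N} => [|k s [IH0 IH]] //=.
  set l := foldr _ _ _ in IH0 IH *.
  case: (leP (normc (u k)) (normc (u l))) => kl; split=> //.
  - by move=> j; rewrite in_cons => /predU1P[->|/IH].
  - exact: le_trans IH0 (ltW kl).
  - by move=> j; rewrite in_cons => /predU1P[->|/IH /le_trans]; [|apply; exact: ltW].
exists N => n; have [/Ns//|ns] := boolP (n \in s).
apply: le_trans N0; apply: le_trans (ltW Fe).
apply: le_trans (nsum_ub n (nfin_restr _ uf)).
rewrite /restr ifT//; apply/mem_set => /= ns'.
by rewrite ns' in ns.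
Qed.

Definition unit_vec (k : int) : int -> C := fun n => (n == k)%:R.

Lemma unit_vec_mem k : unit_vec k \in @l1Z_pred R.
Proof.
apply/l1Z_predP; apply: (proj1 (csum1 (t0 := k) _)) => n nk.
by rewrite /unit_vec (negbTE nk).
Qed.

Definition e_ (k : int) : l1Z R := L1Z (unit_vec_mem k).

Lemma pi1_monomial (x : Sg) (f : Sg -> C) (fc : continuous f) n k :
  pi1 R x (l1Sigma_monomial fc n) (e_ k) = f (sigmaz (k + n) x) *: e_ (k + n).
Proof.
apply: l1ZP => m; rewrite -[RHS]/(_ * unit_vec _ _) /= /pi1_val.
rewrite (zsum1 (k := n)) => [|j jn]; last first.
  by rewrite /= /monomial (negbTE jn) mul0r.
rewrite /= /monomial eqxx /unit_vec subr_eq.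
by case: eqP => [->//|]; rewrite !mulr0.
Qed.

Lemma pi1_C (x : Sg) (f : Sg -> C) (fc : continuous f) k :
  pi1 R x (l1Sigma_monomial fc 0) (e_ k) = f (sigmaz k x) *: e_ k.
Proof. by rewrite pi1_monomial addr0. Qed.

Lemma pi1_delta (x : Sg) k :
  pi1 R x (l1Sigma_monomial (@cst1_continuous R Sg) 1) (e_ k) = e_ (k + 1).
Proof. by rewrite pi1_monomial scale1r. Qed.

Lemma pi1_unital (x : Sg) u : pi1 R x 1 u = u.
Proof.
apply: l1ZP => m; rewrite /= /pi1_val (zsum1 (k := 0)) => [|j j0].
  by rewrite /= /monomial eqxx mul1r subr0.
by rewrite /= /monomial (negbTE j0) mul0r.
Qed.

Lemma pi1_contractive (x : Sg) a u :
  l1Z_norm (pi1 R x a u) <= l1Sigma_norm a * l1Z_norm u.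
Proof.
rewrite -[leRHS](nsum_conv (l1Sigma_nfin a) (l1Z_cfin u)).
apply: nsum_le; last exact: (nfin_conv (l1Sigma_nfin a) (l1Z_cfin u)).
by move=> m; rewrite normc_ge0/=; exact: pi1_le.
Qed.

End facts.

(* Main.v *)
(* Some [f] in C(X) separates [sigma^N x] from finitely many other points of the
   orbit of [x], which are distinct from it as [x] is aperiodic. If [N] is an
   index of maximal modulus of [rho], it follows that [pi1 (f / rho N) rho] is
   [e_N] up to a small error. A weighted sum [\sum_n c_n delta^n f / rho N] is
   then mapped to the convolution of [c] with a small perturbation of [e_N],
   and a Neumann series in l^1(Z) finds the [c] for which the result is exactly
   [tau]. *)
Require Import Defs.
From mathcomp Require Import all_boot all_order all_algebra.
From mathcomp Require Import boolp classical_sets reals topology normedtype.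
From mathcomp Require Import complex.
From mathcomp Require Import functions cardinality ereal sequences esum zify.

Set Implicit Arguments.
Unset Strict Implicit.
Unset Printing Implicit Defensive.

Import Order.TTheory GRing.Theory Num.Theory.
Import numFieldNormedType.Exports Normc.

Local Open Scope classical_set_scope.
Local Open Scope ring_scope.

(** * Periodic points and aperiodic orbits *)

Lemma sigmaz_periodic (Sg : dynSys) (x : Sg) (p k : int) :
  sigmaz p x = x -> sigmaz (k * p) x = x.
Proof.
move=> px; elim/int_ind: k => [|n IH|n IH]; first by rewrite mul0r.
  by rewrite -addn1 PoszD mulrDl mul1r sigmazD px.
have npx : sigmaz (- p) x = x by rewrite -{1}px -sigmazD addNr.
by rewrite -addn1 PoszD opprD mulrDl mulN1r sigmazD npx.
Qed.

(** A coincidence at [j < i] makes [x] periodic with period [p = i - j]; reducing exponents modulo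
    [p] then leaves at most [p] orbit points. *)
Lemma Aper_inj (Sg : dynSys) (x : Sg) :
  Aper x -> injective (fun n => sigmaz n x).
Proof.
move=> xA i j ij; apply/eqP/negP => /negP; wlog ji : i j ij / j < i => [H|_].
  by case: (ltgtP i j) => // h _; [apply: (H j i)|apply: (H i j)];
    rewrite ?gt_eqF.
have [p p0 ijp] : exists2 p : nat, (0 < p)%N & i - j = p.
  by move: ji; rewrite -subr_gt0; case: (i - j) => // p; exists p.
have px : sigmaz p x = x.
  by rewrite -ijp addrC sigmazD ij -sigmazD addNr.
apply: xA; apply: (@sub_finite_set _ _ ((fun n : nat => sigmaz n x) @` `I_p)).
  have p0' : p%:Z != 0 by case: (p) p0.
  move=> _ [n _ <-]; exists `|(n %% p)%Z|%N.
    by rewrite /= -ltz_nat gez0_abs ?modz_ge0 ?ltz_pmod.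
  rewrite gez0_abs ?modz_ge0//.
  have nE : n = (n %% p)%Z + (n %/ p)%Z * p by rewrite addrC -divz_eq.
  by rewrite [in RHS]nE [RHS]sigmazD sigmaz_periodic.
exact/finite_image/finite_II.
Qed.

(** * Absolutely summable families *)

Lemma nfin_geometric (R : realType) (c r : R) :
  0 <= c -> 0 <= r < 1 -> nfin (fun n : nat => r ^+ n * c).
Proof.
move=> c0 /andP[r0 r1].
have g0 n : 0 <= r ^+ n * c by rewrite mulr_ge0 ?exprn_ge0.
split=> //; rewrite -nneseries_esumT => [|n]; last by rewrite lee_fin.
apply: (@le_lt_trans _ _ (c / (1 - r))%:E); last exact: ltry.
apply: lime_le; first by apply: is_cvg_nneseries => n _ _; rewrite lee_fin.
apply: nearW => n; rewrite sumEFin lee_fin.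
have -> : \sum_(0 <= k < n) r ^+ k * c = series (geometric c r) n.
  by apply: eq_bigr => k _; rewrite mulrC.
rewrite geometric_seriesE ?lt_eqF//=.
rewrite ler_pM2r ?invr_gt0 ?subr_gt0// ler_piMr// gerBl.
exact: exprn_ge0.
Qed.

Lemma nfin_comp_inj (R : realType) (T T' : choiceType) (e : T -> T')
    (g : T' -> R) : injective e -> nfin g -> nfin (g \o e).
Proof.
move=> ei gf; split=> [t|]; first exact: gf.1.
have e_bij : set_bij setT (range e) e by split=> // ? ? _ _; exact: ei.
rewrite -(reindex_esum _ _ _ (EFin \o g) e_bij) esum_mkcond.
have [_] := nfin_restr (range e) gf; apply: le_lt_trans.
by apply: le_esum => t _; rewrite /restr; case: ifP.
Qed.

(** The sum of the shifted family and the sum of [u] over [range succn] are limits of the same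
    series; what remains is the index 0. *)
Lemma csum_recl (R : realType) (u : nat -> R[i]) :
  cfin u -> csum u = u 0%N + csum (u \o succn).
Proof.
move=> uf.
have tailf : cfin (u \o succn) by exact: nfin_comp_inj succn_inj uf.
have tailE : csum (u \o succn) = csum (restr (range succn) u).
  have := csum_series (@inj_id nat) tailf.
  have -> : restr (range id) (u \o succn) = u \o succn.
    by apply/funext => n; rewrite /restr mem_set//; exists n.
  by move/cvg_unique; apply; [exact: norm_hausdorff|exact: csum_series succn_inj uf].
rewrite tailE -[X in X + _](csum_restr1 0%N u) -csum_restrU//; last first.
  by apply/seteqP; split => // _ [-> []].
congr csum; apply/funext => -[|n]; rewrite /restr mem_set//; first by left.
by right; exists n.
Qed.

Lemma cfin_conv1 (R : realType) (u v : int -> R[i]) n :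
  cfin u -> cfin v -> cfin (fun k => u k * v (n - k)).
Proof.
move=> uf vf; apply: cfin_le (nfin_conv1 n uf vf) => k.
by rewrite normcM.
Qed.

(** * Convolution equations in l^1(Z) *)

Section convolution_equation.
Context (R : realType).
Local Notation C := R[i].
Variables s v : int -> C.
Hypotheses (sf : cfin s) (vf : cfin v).
Let r := nsum (fun n => normc (s n)).
Hypothesis r1 : r < 1.

Let nterm (k : nat) : int -> C :=
  iter k (fun u m => - zsum (fun n => s n * u (m - n))) v.

(** Convolution is submultiplicative for the l^1 norm, so each further factor [- s] costs at most a
    factor [r]. *)
Let nterm_bound k : cfin (nterm k) /\
  nsum (fun m => normc (nterm k m)) <= r ^+ k * nsum (fun m => normc (v m)).
Proof.
elim: k => [|k [uf ub]]; first by rewrite expr0 mul1r.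
have le m : normc (nterm k.+1 m) <=
    nsum (fun n => normc (s n) * normc (nterm k (m - n))).
  rewrite normcN; apply: zsum_le => [n|]; first by rewrite normcM.
  exact: (nfin_conv1 m sf uf).
split; first exact: (cfin_le le (nfin_conv sf uf)).
apply: (@le_trans _ _ (r * nsum (fun m => normc (nterm k m)))).
  rewrite -(nsum_conv sf uf); apply: nsum_le (nfin_conv sf uf) => m.
  by rewrite normc_ge0 le.
by rewrite exprS -mulrA ler_wpM2l// nsum_ge0.
Qed.

(* The solution is the Neumann series [\sum_k (-s)^{*k} * v]. *)
Lemma conv_eq_solvable : exists2 d : int -> C, cfin d &
  forall m, d m + zsum (fun n => s n * d (m - n)) = v m.
Proof.
pose w (t : nat * int) := nterm t.1 t.2.
have r0 : 0 <= r by exact: nsum_ge0.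
have v0 : 0 <= nsum (fun m => normc (v m)) by exact: nsum_ge0.
(* Geometric decay makes all terms one summable family on [nat * int], which permits the exchange of
   sums below. *)
have wf : cfin w.
  apply: nfin_pair => [k|]; first exact: (proj1 (nterm_bound k)).
  apply: nfin_le (nfin_geometric v0 (_ : 0 <= r < 1)) => [k|]; last first.
    by rewrite r0 r1.
  rewrite (proj2 (nterm_bound k)) andbT.
  exact: (nsum_ge0 (proj1 (nterm_bound k))).
have swf : cfin (fun t : int * nat => w (t.2, t.1)).
  by apply: (nfin_reindex (e := fun t => (t.2, t.1))
    (e' := fun t => (t.2, t.1)) _ _ wf); case.
pose d m := csum (fun k => w (k, m)).
have df : cfin d by exact: (cfin_csum swf).
have slice m : cfin (fun k => w (k, m)) by exact: (cfin_slice m swf).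
exists d => // m.
have split0 : d m = v m + csum (fun k => w (k.+1, m)).
  exact: csum_recl (slice m).
have sdf : cfin (fun t : int * nat => s t.1 * w (t.2, m - t.1)).
  apply: nfin_pair => [n|] /=; first by apply: cfinZ; exact: slice.
  have -> : (fun n => nsum (fun k => normc (s n * w (k, m - n)))) =
      (fun n => normc (s n) * nsum (fun k => normc (w (k, m - n)))).
    apply/funext => n; under eq_fun do rewrite normcM.
    by rewrite nsumZ ?normc_ge0//; exact: slice.
  exact: (nfin_conv1 m sf (nfin_nsum swf)).
(* Each term is minus the convolution of [s] with its predecessor, so the terms from index 1 on add
   up to [- s * d]. *)
have tails : csum (fun k => w (k.+1, m)) = - zsum (fun n => s n * d (m - n)).
  rewrite zsumE; last exact: cfin_conv1.
  have -> : (fun n => s n * d (m - n)) =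
      (fun n => csum (fun k => s n * w (k, m - n))).
    by apply/funext => n; rewrite csumZ.
  have sdf' : cfin (fun t : nat * int => s t.2 * w (t.1, m - t.2)).
    by apply: (nfin_reindex (e := fun t => (t.2, t.1))
      (e' := fun t => (t.2, t.1)) _ _ sdf); case.
  rewrite (csum_exchange sdf) -mulN1r -csumZ; last exact: (cfin_csum sdf').
  congr csum; apply/funext => k; rewrite mulN1r; congr (- _).
  by rewrite -zsumE//; exact: (cfin_slice k sdf').
by rewrite split0 tails addrNK.
Qed.

End convolution_equation.

(** Take l^1 norms in [d = v - s * d] and bound the norm of the convolution by the product of the
    norms. *)
Lemma conv_eq_bound (R : realType) (s v d : int -> R[i]) :
  cfin s -> cfin v -> cfin d ->
  (forall m, d m + zsum (fun n => s n * d (m - n)) = v m) ->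
  nsum (fun m => normc (d m)) * (1 - nsum (fun n => normc (s n))) <=
  nsum (fun m => normc (v m)).
Proof.
move=> sf vf df dE; rewrite mulrBr mulr1 lerBlDr mulrC -(nsum_conv sf df).
have cf := nfin_conv sf df; rewrite -nsumD//.
apply: nsum_le => [m|]; last exact: nfinD.
rewrite normc_ge0 /= -(addrK (zsum (fun n => s n * d (m - n))) (d m)) dE.
apply: le_trans (normcD_le _ _) _; rewrite normcN lerD2l.
by apply: zsum_le (nfin_conv1 m sf df) => n; rewrite normcM.
Qed.

(** Serves to swap the two factors of a convolution. *)
Lemma zsum_reflect (R : realType) (u : int -> R[i]) (p : int) :
  cfin u -> zsum (fun k => u (p - k)) = zsum u.
Proof.
have pK : involutive (fun k : int => p - k) by move=> k; rewrite opprB addrC subrK.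
move=> uf; rewrite !zsumE//; last exact: (nfin_reindex pK pK uf).
exact: (csum_reindex pK pK uf).
Qed.

(** * Separation by continuous functions *)

Lemma normc_real (R : realType) (r : R) : normc r%:C%C = `|r|.
Proof. by rewrite /= expr0n addr0 sqrtr_sqr. Qed.

Lemma continuous_complex (R : realType) (T : topologicalType) (h : T -> R) :
  continuous h -> continuous (fun y => (h y)%:C%C).
Proof.
move=> hc y; apply/ccvgP => e e0.
have /cvgrPdist_lt/(_ _ e0) := hc y; apply: filterS => z.
by rewrite -rmorphB normc_real.
Qed.

(** Urysohn's lemma: a compact Hausdorff space is normal, and its finite subsets are closed. *)
Lemma dynSys_separation (R : realType) (Sg : dynSys) (A : set Sg) (y : Sg) :
  finite_set A -> ~ A y -> exists h : Sg -> R, [/\ continuous h,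
    forall z, 0 <= h z <= 1, forall z, A z -> h z = 0 & h y = 1].
Proof.
move=> Af Ay.
have fclosed := (@accessible_finite_set_closed Sg).1
  (hausdorff_accessible (@dyn_hausdorff Sg)).
have /(@normal_separatorP R) sep :=
  compact_normal (@dyn_hausdorff Sg) (@dyn_compact Sg).
have Ay0 : A `&` [set y] = set0 by apply/seteqP; split=> // z [Az zy]; rewrite zy in Az.
have /(@uniform_separatorP _ R)[h [hc h01 hA hy]] :=
  sep _ _ (fclosed _ Af) (fclosed _ (finite_set1 y)) Ay0.
exists h; split=> // [z|z Az|].
- by have := h01 (h z); rewrite /= in_itv/=; apply; exists z.
- by apply: hA; exists z.
- by apply: hy; exists y.
Qed.

(** * Inverting convolution by a perturbed unit vector *)

(* [w] is a small perturbation of [e_N], so that convolution by [w] is, up to a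
   shift, a small perturbation of the identity. *)
Lemma deconvolution (R : realType) (w v : int -> R[i]) (N : int) (r : R) :
  cfin w -> cfin v -> w N = 1 ->
  nsum (fun n => normc (restr (~` [set N]) w n)) <= r -> r < 1 ->
  exists c : int -> R[i], [/\ cfin c,
    forall m, zsum (fun n => c n * w (m - n)) = v m &
    nsum (fun n => normc (c n)) * (1 - r) <= nsum (fun n => normc (v n))].
Proof.
move=> wf vf wN wr r1.
have NK : cancel (fun k : int => k + N) (fun k => k - N).
  by move=> k; rewrite addrK.
have KN : cancel (fun k : int => k - N) (fun k => k + N).
  by move=> k; rewrite subrK.
have w'f := cfin_restr (~` [set N]) wf.
(* Translation by [N] moves the main coordinate to 0: [w (k + N)] is [e_0] plus [s]. The same
   translation, applied to the solution [d], gives [c]. *)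
pose s k := restr (~` [set N]) w (k + N).
have sf : cfin s := nfin_reindex NK KN w'f.
have sr : nsum (fun n => normc (s n)) <= r.
  by move: wr; rewrite -(nsum_reindex NK KN w'f).
have [d df dE] := conv_eq_solvable sf vf (le_lt_trans sr r1).
have cf : cfin (fun n => d (n + N)) := nfin_reindex NK KN df.
exists (fun n => d (n + N)); split=> // [m|].
  rewrite -dE -(zsum_reflect (m - N) (cfin_conv1 m cf wf)).
  (* [d m] becomes the convolution of [e_0] with [d], so that both sides can be compared term by
     term. *)
  rewrite (_ : d m = zsum (fun k => if k == 0 then d m else 0)); last first.
    by rewrite (zsum1 (k := 0)) ?eqxx// => k /negbTE ->.
  rewrite -zsumD; last 2 first.
  - by apply: (proj1 (csum1 (t0 := 0) _)) => k /negbTE ->.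
  - exact: cfin_conv1.
  congr zsum; apply/funext => k.
  have -> : m - N - k + N = m - k by rewrite addrAC subrK.
  have -> : m - (m - N - k) = k + N by lia.
  rewrite /s /restr; case: eqP => [->|/eqP k0].
    rewrite add0r wN mulr1 subr0 memNset ?mul0r ?addr0//.
    by move=> /(_ erefl).
  rewrite mem_set ?add0r 1?mulrC//= => /eqP.
  by rewrite -subr_eq0 addrK (negbTE k0).
rewrite (nsum_reindex NK KN df).
apply: le_trans (conv_eq_bound sf vf df dE).
by rewrite ler_wpM2l ?nsum_ge0// lerB.
Qed.

(** * Transitivity on nonzero vectors and irreducibility *)

Lemma l1Z_max_gt0 (R : realType) (rho : l1Z R) : rho != 0 -> 0 < l1Z_max rho.
Proof.
move=> rho0; have [N [-> Nmax]] := l1Z_max_attained rho.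
rewrite lt_neqAle normc_ge0 andbT; apply: contra rho0 => /eqP N0.
apply/eqP/l1ZP => n; apply: eq0_normc; apply/eqP.
by rewrite eq_le normc_ge0 andbT N0.
Qed.

Lemma pi1_solvable (R : realType) (Sg : dynSys) (x : Sg)
    (rho tau : l1Z R) (eps : R) :
  Aper x -> rho != 0 -> 0 < eps ->
  exists a : l1Sigma R Sg,
    pi1 R x a rho = tau /\
    l1Sigma_norm a <= (1 + eps) / l1Z_max rho * l1Z_norm tau.
Proof.
move=> xA rho0 e0; have M0 := l1Z_max_gt0 rho0.
have [N [ME _]] := l1Z_max_attained rho.
set M := l1Z_max rho in M0 ME *.
have MV0 : 0 <= M^-1 by rewrite invr_ge0 ltW.
have rf := l1Z_cfin rho.
have e1 : 0 < 1 + eps by rewrite addr_gt0.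
(* Chosen so that the Neumann factor [1 / (1 - delta)] is exactly [1 + eps]. *)
pose delta := eps / (1 + eps).
have delta0 : 0 < delta by rewrite divr_gt0.
have deltaE : 1 - delta = (1 + eps)^-1.
  apply: (mulIf (lt0r_neq0 e1)); rewrite mulrBl divfK ?mulVf ?lt0r_neq0//.
  by rewrite mul1r addrK.
have delta1 : delta < 1 by rewrite -subr_gt0 deltaE invr_gt0.
(* The threshold [delta * M] turns into [delta] after the division by [rho N], whose modulus is
   [M]. *)
have [F Ff Fd] := nsum_tail rf (mulr_gt0 delta0 M0).
have [h [hc h01 hF hN]] : exists h : Sg -> R, [/\ continuous h,
    forall z, 0 <= h z <= 1,
    forall z, ((fun n => sigmaz n x) @` (F `\ N)) z -> h z = 0
    & h (sigmaz N x) = 1].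
  apply: dynSys_separation; first exact/finite_image/finite_setD.
  by move=> [n [_ /= nN] /(Aper_inj xA)].
have rhoN0 : rho N != 0.
  by apply: contraTneq M0 => rN; rewrite ME rN normc0 ltxx.
pose f y : R[i] := (rho N)^-1 * ((h y)%:C)%C.
have fc : continuous f.
  by move=> y; apply: cvgM; [exact: cvg_cst|exact: continuous_complex].
have f_le y : normc (f y) <= M^-1.
  have /andP[h0 h1] := h01 y.
  by rewrite normcM normcV -ME normc_real ger0_norm// ler_piMr.
(* the coordinates of [pi1 f rho] *)
pose w k := f (sigmaz k x) * rho k.
have wN : w N = 1 by rewrite /w /f hN mulr1 mulVf.
have w_le k : normc (w k) <= M^-1 * normc (rho k).
  by rewrite normcM ler_wpM2r ?normc_ge0.
have wf : cfin w by exact: cfin_le w_le (nfinZ MV0 rf).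
have w_tail : nsum (fun n => normc (restr (~` [set N]) w n)) <= delta.
  pose g k := M^-1 * restr (~` F) (fun n => normc (rho n)) k.
  apply: (@le_trans _ _ (nsum g)); last first.
    rewrite nsumZ//; last exact: nfin_restr.
    by rewrite ler_pdivrMl// mulrC ltW.
  (* Off [N], [w] vanishes on [F] because [h] does, and outside [F] it is dominated by the tail of
     [rho] over [M]. *)
  have gf : nfin g by apply: nfinZ => //; exact: nfin_restr.
  have [g0 _] := gf; apply: nsum_le gf => k; rewrite normc_ge0 /=.
  rewrite {1}/restr; case: ifPn => [/set_mem kN|_]; last by rewrite normc0 g0.
  rewrite /g /restr; case: ifPn => [_|]; first exact: w_le.
  rewrite in_setC negbK => /set_mem kF.
  by rewrite /w /f hF ?mulr0 ?mul0r ?normc0//; exists k.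
have [c [cf cE c_le]] := deconvolution wf (l1Z_cfin tau) wN w_tail delta1.
(* The coefficients of [c_n delta^n f], since [delta^n f = alpha^n(f) delta^n]; hence [pi1 a rho] is
   the convolution of [c] with [w]. *)
pose a n y := c n * f (sigmaz (- n) y).
have a_le n y : normc (a n y) <= M^-1 * normc (c n).
  by rewrite normcM mulrC ler_wpM2r ?normc_ge0.
have ac n : continuous (a n).
  move=> y; apply: cvgM; first exact: cvg_cst.
  by apply: continuous_comp; [exact: sigmaz_continuous|exact: fc].
have cMf := nfinZ MV0 cf.
exists (L1Sigma (l1Sigma_intro ac a_le cMf)); split.
  apply: l1ZP => m; rewrite -cE; congr zsum; apply/funext => n.
  by rewrite /= /a /w -sigmazD [- n + m]addrC mulrA.
(* The factor [M^-1] bounds the sup norm of [f]; the factor [1 + eps] comes from the bound on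
   [c]. *)
apply: (@le_trans _ _ (M^-1 * nsum (fun n => normc (c n)))).
  rewrite -nsumZ// -[l1Sigma_norm _]/(nsum (fun n => supnorm (a n))).
  apply: nsum_le cMf => n; rewrite supnorm_ge0//=.
  exact: supnorm_le.
rewrite [_ / M]mulrC -mulrA ler_wpM2l//.
by rewrite -ler_pdivrMl// mulrC -deltaE.
Qed.

Theorem proposition3p13 (R : realType) (Sg : dynSys) (x : Sg) (hx : Aper x) :
  alg_irreducible (pi1 R x) /\
  forall (rho tau : l1Z R) (eps : R), rho != 0 -> 0 < eps ->
    exists a : l1Sigma R Sg,
      pi1 R x a rho = tau /\
      l1Sigma_norm a <= (1 + eps) / l1Z_max rho * l1Z_norm tau.
Proof.
split; last by move=> rho tau eps; exact: pi1_solvable hx.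
split.
  exists 1, (e_ R 0); rewrite pi1_unital; apply/eqP.
  move=> /(congr1 (fun u : l1Z R => u 0))/eqP.
  by rewrite /= /unit_vec eqxx oner_eq0.
move=> W [W0 _] Winv.
have [[rho [rhoW rho0]]|W_only0] := pselect (exists rho, rho \in W /\ rho != 0).
  (* Every [tau] is the image of [rho] under some [a], here taken with [eps = 1], and [W] is
     invariant. *)
  right=> tau; have [a [<- _]] := pi1_solvable tau hx rho0 ltr01.
  exact: Winv.
left=> rho; rewrite [RHS]inE; apply/idP/eqP => [rhoW|->//].
apply: contrapT => /eqP rho0; apply: W_only0.
by exists rho.
Qed.
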